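(* Let $Z_1^*=S_1/S_2$. (i) Under the squared error loss $L_1$, the estimator of $\sigma_2^2$ $$\delta_{21}^Q=\begin{cases}\dfrac{(1+Z_1^* )S_2}{m_1+m_2+2}\,\dfrac{E(\tau^{-1})}{E(\tau^{-2})},&\text{if }Z_1^*\ge\dfrac{m_1}{m_2+2},\\[1em] \dfrac{S_2}{m_2+2}\,\dfrac{E(\tau^{-1})}{E(\tau^{-2})},&\text{otherwise,}\end{cases}$$ improves upon (dominates) $\delta_{02}^Q=\dfrac{E(\tau^{-1})}{(m_2+2)E(\tau^{-2})}S_2$. (ii) Under the entropy loss $L_2$, the estimator of $\sigma_2^2$ $$\delta_{21}^E=\begin{cases}\dfrac{(1+Z_1^* )S_2}{(m_1+m_2)E(\tau^{-1})},&\text{if }Z_1^*\ge\dfrac{m_1}{m_2},\\[1em] \dfrac{S_2}{m_2E(\tau^{-1})},&\text{otherwise,}\end{cases}$$ dominates $\delta_{02}^E=\dfrac{S_2}{m_2E(\tau^{-1})}$.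
   Context: Model: $p,q,m_1,m_2$ are positive integers; $\tau$ is a positive random variable (mixing variable) with known distribution $\Pi$ on $(0,\infty)$, such that the moments $E(\tau^{-1})$ and (for the squared error loss) $E(\tau^{-2})$ are finite. Conditionally on $\tau$, the variables $\boldsymbol X_1,S_1,\boldsymbol X_2,S_2$ are independent with $\boldsymbol X_1\sim N_p(\boldsymbol\theta_1,\frac{\sigma_1^2}{\tau}I)$, $S_1\sim\frac{\sigma_1^2}{\tau}\chi^2_{m_1}$, $\boldsymbol X_2\sim N_q(\boldsymbol\theta_2,\frac{\sigma_2^2}{\tau}I)$, $S_2\sim\frac{\sigma_2^2}{\tau}\chi^2_{m_2}$ (the same $\tau$ for all four). The unknown parameters are $\boldsymbol\theta_1\in\mathbb R^p$, $\boldsymbol\theta_2\in\mathbb R^q$, $\sigma_1,\sigma_2>0$ with the order restriction $\sigma_1\le\sigma_2$. Losses for estimating $\sigma^2$ by $\delta$: squared error loss $L_1(\delta,\sigma^2)=(\delta/\sigma^2-1)^2$ and entropy loss $L_2(\delta,\sigma^2)=\delta/\sigma^2-\ln(\delta/\sigma^2)-1$. The risk $R(\delta)$ of an estimator $\delta$ of $\sigma_2^2$ is the expected loss, a function of the parameters. $\delta_{02}^Q$ and $\delta_{02}^E$ (the best affine equivariant estimators, BAEE, of $\sigma_2^2$ under $L_1$ and $L_2$) are understood to have finite risk. An estimator $\delta'$ dominates (improves upon) $\delta$ if $R(\delta')\le R(\delta)$ for all admissible parameter values, with strict inequality for at least one. *)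

(* Defs.v *)
From mathcomp Require Import all_boot all_order all_algebra.
From mathcomp Require Import all_classical all_reals all_analysis.

Set Implicit Arguments.
Unset Strict Implicit.
Unset Printing Implicit Defensive.

Import Order.TTheory GRing.Theory Num.Theory.
Import numFieldNormedType.Exports.

Local Open Scope classical_set_scope.
Local Open Scope ring_scope.

Section distributions.
Context {R : realType}.

Definition Gamma_fun (a : R) : R :=
  \int[@lebesgue_measure R]_(x in `]0, +oo[) (x `^ (a - 1) * expR (- x)).

Definition chi2_pdf (m : nat) (x : R) : R :=
  if 0 < x then
    x `^ (m%:R / 2 - 1) * expR (- (x / 2)) /
      (2 `^ (m%:R / 2) * Gamma_fun (m%:R / 2))
  else 0.

Definition chi2_prob (m : nat) (B : set R) : \bar R :=
  (\int[@lebesgue_measure R]_(x in B) (chi2_pdf m x)%:E)%E.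

(* Law of [v * Y] where [Y] is chi-squared with [m] degrees of freedom. *)
Definition scaled_chi2_prob (m : nat) (v : R) (B : set R) : \bar R :=
  chi2_prob m [set y | B (v * y)].

(* Value of N_n(theta, v I) on the box [A 0 x ... x A (n-1)]; the boxes form a
   pi-system generating the Borel sets of R^n. The second argument of
   [normal_prob] is a standard deviation. *)
Definition iso_normal_box (n : nat) (theta : 'rV[R]_n) (v : R)
    (A : 'I_n -> set R) : \bar R :=
  (\prod_(i < n) normal_prob (theta ord0 i) (Num.sqrt v) (A i))%E.

End distributions.

Record param (R : realType) (p q : nat) := Param {
  theta1 : 'rV[R]_p;
  theta2 : 'rV[R]_q;
  sigma1 : R;
  sigma2 : R }.

Definition admissible (R : realType) (p q : nat) (w : param R p q) : Prop :=
  [/\ 0 < sigma1 w, 0 < sigma2 w & sigma1 w <= sigma2 w].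

(* [tau] has law [Pi] and, given [tau = t], the vectors [X1], [X2] and the
   variables [S1], [S2] are independent with laws N_p(theta1, (sigma1^2 / t) I),
   N_q(theta2, (sigma2^2 / t) I), (sigma1^2 / t) chi2_m1, (sigma2^2 / t) chi2_m2.
   The last clause is the disintegration of the joint law along [tau]. *)
Record scale_mixture_model (R : realType) (p q m1 m2 : nat)
    (Pi : probability R R) (d : measure_display) (T : measurableType d)
    (P : probability T R) (tau : T -> R) (X1 : T -> 'rV[R]_p) (S1 : T -> R)
    (X2 : T -> 'rV[R]_q) (S2 : T -> R) (w : param R p q) : Prop := {
  meas_tau : measurable_fun setT tau;
  meas_X1 : forall i, measurable_fun setT (fun x => X1 x ord0 i);
  meas_S1 : measurable_fun setT S1;
  meas_X2 : forall j, measurable_fun setT (fun x => X2 x ord0 j);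
  meas_S2 : measurable_fun setT S2;
  law_tau : forall C : set R, measurable C -> P (tau @^-1` C) = Pi C;
  cond_law : forall (C B1 B2 : set R) (A1 : 'I_p -> set R) (A2 : 'I_q -> set R),
    measurable C -> measurable B1 -> measurable B2 ->
    (forall i, measurable (A1 i)) -> (forall j, measurable (A2 j)) ->
    (P [set x | [/\ C (tau x), (forall i, A1 i (X1 x ord0 i)), B1 (S1 x),
                    (forall j, A2 j (X2 x ord0 j)) & B2 (S2 x)]] =
     \int[Pi]_(t in C)
       (iso_normal_box (theta1 w) (sigma1 w ^+ 2 / t)%R A1 *
        scaled_chi2_prob m1 (sigma1 w ^+ 2 / t)%R B1 *
        iso_normal_box (theta2 w) (sigma2 w ^+ 2 / t)%R A2 *
        scaled_chi2_prob m2 (sigma2 w ^+ 2 / t)%R B2))%E }.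

Section risk.
Context {R : realType}.

Definition squared_loss (delta s : R) : R := (delta / s - 1) ^+ 2.

Definition entropy_loss (delta s : R) : R := delta / s - ln (delta / s) - 1.

(* Risk, at parameter [w], of [delta] as an estimator of sigma2^2. *)
Definition risk (p q : nat) (d : measure_display) (T : measurableType d)
    (P : param R p q -> probability T R) (L : R -> R -> R) (delta : T -> R)
    (w : param R p q) : \bar R :=
  'E_(P w)[fun x => L (delta x) (sigma2 w ^+ 2)%R]%E.

Definition finite_risk (p q : nat) (d : measure_display) (T : measurableType d)
    (P : param R p q -> probability T R) (L : R -> R -> R) (delta : T -> R) :=
  forall w, admissible w -> risk P L delta w \is a fin_num.

Definition dominates (p q : nat) (d : measure_display) (T : measurableType d)
    (P : param R p q -> probability T R) (L : R -> R -> R)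
    (delta' delta : T -> R) : Prop :=
  (forall w, admissible w -> risk P L delta' w <= risk P L delta w)%E /\
  (exists w, admissible w /\ risk P L delta' w < risk P L delta w)%E.

End risk.

Section estimators.
Context {R : realType}.

(* E(tau^-k) for [tau] with law [Pi]. *)
Definition inv_moment (Pi : probability R R) (k : nat) : \bar R :=
  'E_Pi[fun t : R => (t ^- k)%R]%E.

Context (m1 m2 : nat) (Pi : probability R R).
Let e1 : R := fine (inv_moment Pi 1).
Let e2 : R := fine (inv_moment Pi 2).

(* Estimators as functions of the observed values of S1 and S2. *)

Definition delta02Q (s2 : R) : R := e1 / ((m2 + 2)%:R * e2) * s2.

Definition delta21Q (s1 s2 : R) : R :=
  let z := s1 / s2 in
  if m1%:R / (m2 + 2)%:R <= z
  then (1 + z) * s2 / (m1 + m2 + 2)%:R * (e1 / e2)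
  else s2 / (m2 + 2)%:R * (e1 / e2).

Definition delta02E (s2 : R) : R := s2 / (m2%:R * e1).

Definition delta21E (s1 s2 : R) : R :=
  let z := s1 / s2 in
  if m1%:R / m2%:R <= z
  then (1 + z) * s2 / ((m1 + m2)%:R * e1)
  else s2 / (m2%:R * e1).

End estimators.

(* Main.v *)
Require Import Defs.
From HB Require Import structures.
From mathcomp Require Import all_boot all_order all_algebra.
From mathcomp Require Import all_classical all_reals all_analysis.
From mathcomp Require Import measurable_realfun ring lra.
Import Order.TTheory GRing.Theory Num.Theory.
Import numFieldNormedType.Exports.
Local Open Scope classical_set_scope.
Local Open Scope ring_scope.

Set Implicit Arguments.
Unset Strict Implicit.
Unset Printing Implicit Defensive.

(** Write [Z = S1 / S2] and [W = S1 / sigma1^2 + S2 / sigma2^2]. Given [tau], the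
    variable [tau W] is chi-squared with [M = m1 + m2] degrees of freedom and is
    independent of [Z], whose law does not depend on [tau]; hence
    [E (g Z * W) = E (tau^-1) M E (g Z)] and
    [E (g Z * W^2) = E (tau^-2) M (M + 2) E (g Z)] for every [g >= 0].
    Since [S2 / sigma2^2 = W / (1 + Z sigma2^2 / sigma1^2)], the risk difference
    between two estimators [phi Z * S2] is thus the expectation of a function of
    [Z] alone. The optimal [phi], given [Z], is a constant multiple of
    [1 + Z sigma2^2 / sigma1^2], which is at least the same multiple of [1 + Z]
    because [sigma1 <= sigma2]; so raising the constant of the BAEE to that
    multiple of [1 + Z], where the latter is larger, lowers the risk.

    The moment identities need no Gamma function: they follow from the scaling of
    homogeneous functions under dilations of the plane, and the total mass of the
    chi-squared densities is 1 because the model is a probability. *)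

(** * Lebesgue measure on the plane and dilations *)

Section sigma_finite_product.
Local Open Scope ereal_scope.
Context d1 d2 (T1 : measurableType d1) (T2 : measurableType d2) (R : realType).
Variable m1 : {sigma_finite_measure set T1 -> \bar R}.
Variable m2 : {sigma_finite_measure set T2 -> \bar R}.

Lemma sigma_finite_product_measure1 : sigma_finite setT (m1 \x m2).
Proof.
have [F TF Foo] := sigma_finiteT m1; have [G TG Goo] := sigma_finiteT m2.
(* Numbers that encode no pair go to [(0, 0)], which only repeats a set of finite measure. *)
pose ij n : nat * nat := odflt (0, 0)%N (unpickle n).
exists (fun n => F (ij n).1 `*` G (ij n).2).
  rewrite -setXTT TF TG; apply/seteqP; split => -[x y] /=.
    move=> [[i _ Fx] [j _ Gy]]; exists (pickle (i, j)) => //=.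
    by rewrite /ij pickleK.
  by move=> [n _ [/= Fx Gy]]; split; [exists (ij n).1|exists (ij n).2].
move=> n; have [? ?] := Foo (ij n).1; have [? ?] := Goo (ij n).2.
split; first exact: measurableX.
by rewrite product_measure1E// lte_mul_pinfty// ge0_fin_numE.
Qed.

End sigma_finite_product.

(** A named constant can carry the sigma-finite structure, so that the plane can in turn be a factor
    of a product: with the dilation parameter, and later with [Pi]. *)
Definition leb2 {R : realType} : set (measurableTypeR R * measurableTypeR R) -> \bar R :=
  (@lebesgue_measure R \x @lebesgue_measure R)%E.
HB.instance Definition _ (R : realType) := Measure.on (@leb2 R).
HB.instance Definition _ (R : realType) :=
  Measure_isSigmaFinite.Build _ _ _ (@leb2 R) (sigma_finite_product_measure1 _ _).

Lemma ge0_integral_leb2 {R : realType} (f : R * R -> \bar R) :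
  measurable_fun setT f -> (forall z, 0 <= f z)%E ->
  (\int[leb2]_z f z = \int[lebesgue_measure]_x \int[lebesgue_measure]_y f (x, y))%E.
Proof. by move=> mf f0; exact: fubini_tonelli1. Qed.

Section scaling.
Context {R : realType}.
Local Notation mu := (@lebesgue_measure R).
Local Open Scope ereal_scope.

(** The right-hand side is a measure in [A] that agrees with Lebesgue measure on the intervals []a,
    b]], hence everywhere. *)
Lemma lebesgue_measure_dilation (c : R) (A : set R) : (0 < c)%R -> measurable A ->
  mu A = c%:E * mu ((fun x => c * x)%R @^-1` A).
Proof.
move=> c0 mA.
have mc : measurable_fun setT (fun x : measurableTypeR R => (c * x)%R :
  measurableTypeR R).
  exact: measurable_funM.
pose nu : {measure set (measurableTypeR R) -> \bar R} :=
  mscale (NngNum (ltW c0))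
    (pushforward mu (fun x : measurableTypeR R => (c * x)%R : measurableTypeR R)).
have -> : c%:E * mu ((fun x => c * x)%R @^-1` A) = nu mc A by [].
apply: lebesgue_measure_unique => //= _ [[a b]] _ <-.
rewrite /mscale /= /pushforward.
have -> : ((fun x => c * x)%R @^-1` `]a, b]%classic) = `](a / c)%R, (b / c)%R]%classic.
  apply/seteqP; split => x /=; rewrite !in_itv/= ltr_pdivrMr// ler_pdivlMr//;
  by rewrite ![(x * c)%R]mulrC.
rewrite !lebesgue_measure_itv/= !lte_fin ltr_pM2r ?invr_gt0//.
case: ifPn => _; last by rewrite mule0.
by rewrite -!EFinB -EFinM -mulrBl mulrC divfK// gt_eqF.
Qed.

Lemma ge0_integral_dilation (c : R) (f : R -> \bar R) : (0 < c)%R ->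
  measurable_fun setT f -> (forall x, 0 <= f x) ->
  \int[mu]_x f x = c%:E * \int[mu]_x f (c * x)%R.
Proof.
move=> c0 mf f0.
have mc : measurable_fun setT (fun x : measurableTypeR R => (c * x)%R :
  measurableTypeR R).
  exact: measurable_funM.
pose nu : {measure set (measurableTypeR R) -> \bar R} :=
  mscale (NngNum (ltW c0))
    (pushforward mu (fun x : measurableTypeR R => (c * x)%R : measurableTypeR R)).
rewrite (@eq_measure_integral _ _ _ _ (nu mc)); last first.
  by move=> A mA _; rewrite /nu/= /mscale/= (lebesgue_measure_dilation c0).
by rewrite ge0_integral_mscale//= ge0_integral_pushforward.
Qed.

Lemma ge0_integral_dilation2 (c : R) (f : R * R -> \bar R) : (0 < c)%R ->
  measurable_fun setT f -> (forall z, 0 <= f z) ->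
  \int[leb2]_z f z = (c ^+ 2)%:E * \int[leb2]_z f (c * z.1, c * z.2)%R.
Proof.
move=> c0 mf f0.
have mc : measurable_fun setT (fun z : R * R => (c * z.1, c * z.2)%R).
  by apply/measurable_fun_pairP; split; apply: measurable_funM.
rewrite ge0_integral_leb2// ge0_integral_leb2//; last exact: measurableT_comp.
rewrite /=.
have mF := measurable_fun_fubini_tonelli_F (m2 := mu) f mf f0.
rewrite (ge0_integral_dilation c0) //; last first.
  by move=> x; apply: integral_ge0.
rewrite expr2 EFinM -muleA; congr (_ * _).
rewrite -ge0_integralZl//.
- apply: eq_integral => x _; apply: (ge0_integral_dilation c0) => //.
  exact: measurableT_comp.
- exact: (measurable_fun_fubini_tonelli_F (m2 :=
    mu) (f \o _) (measurableT_comp mf mc) (fun=> f0 _)).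
- by move=> x _; exact: integral_ge0.
- by rewrite lee_fin ltW.
Qed.

End scaling.

(** * Improper integrals over the dilation parameter *)

Section FTC.
Context {R : realType}.
Local Notation mu := (@lebesgue_measure R).
Local Open Scope ereal_scope.

Lemma cvg_powR_pinfty_neg (b : R) : (0 < b)%R ->
  (x `^ (- b))%R @[x --> +oo%R] --> (0%R : R).
Proof.
move=> b0.
apply: (@cvg_trans _ ((expR (- (b * ln x)))%R @[x --> +oo%R])).
  apply: near_eq_cvg; near=> x.
  by rewrite /powR gt_eqF// mulNr.
apply: (@cvg_comp _ _ _ (fun x : R => (b * ln x)%R) (fun z : R => expR (- z))
  _ (pinfty_nbhs R)).
  apply: gt0_cvgMry => //; apply/cvgryPge => A; near=> x.
  by rewrite -[A]expRK ler_ln// posrE ?expR_gt0//.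
exact: cvgr_expR.
Unshelve. all: end_near. Qed.

(** The primitive is [- b^-1 * x ^ (- b)]. With [b = al + 2] this is what remains of the dilation
    parameter once the plane integral has been scaled. *)
Lemma integral_powR_1y (b : R) : (0 < b)%R ->
  \int[mu]_(x in `[1%R, +oo[) (x `^ (- (b + 1)))%:E = b^-1%:E.
Proof.
move=> b0.
have dF (x : R) : (0 < x)%R ->
  is_derive x 1%R (fun x : R => - b^-1 * x `^ (- b))%R (x `^ (- (b + 1)))%R.
  move=> x0; have := is_derive1_powR (- b) x0 => dp.
  apply: is_derive_eq.
  rewrite /GRing.scale/= ?mulr0 ?add0r ?addr0 opprD mulrA mulrNN mulVf ?mul1r//.
  by rewrite gt_eqF.
have gt0 (x : R) : (1 <= x)%R -> (0 < x)%R by exact: lt_le_trans.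
rewrite (@ge0_continuous_FTC2y _ _ (fun x => - b^-1 * x `^ (- b))%R 1%R 0%R).
- by rewrite powR1 mulr1 sub0e EFinN oppeK.
- by move=> x _; rewrite powR_ge0.
- apply: continuous_in_subspaceT => x; rewrite inE/= in_itv/= andbT => /gt0 x0.
  apply: differentiable_continuous; apply/derivable1_diffP.
  by apply: derivable_powR; rewrite in_itv/= x0.
- rewrite [X in _ --> X](_ : _ = (- b^-1 * 0)%R); last by rewrite mulr0.
  by apply: cvgMr; exact: cvg_powR_pinfty_neg.
- by move=> x x1; have [] := dF x (lt_trans ltr01 x1).
- apply: cvg_at_right_filter.
  by apply: (@differentiable_continuous _ _ _ _ (fun x => - b^-1 * x `^ (- b))%R);
    apply/derivable1_diffP; have [] := dF _ ltr01.
- move=> x; rewrite in_itv/= andbT => x1; rewrite derive1E.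
  by have [_ ->] := dF x (lt_trans ltr01 x1).
Qed.

Lemma integral_expR_1y (s : R) : (0 < s)%R ->
  \int[mu]_(l in `[1%R, +oo[) (s * expR (- (l * s)))%:E = (expR (- s))%:E.
Proof.
move=> s0.
have dF (x : R) : is_derive x 1%R (fun l : R => - expR (- (l * s)))%R (s * expR (- (x
  * s)))%R.
  apply: is_derive_eq.
  by rewrite /GRing.scale/= ?mulr0 ?mulr1 ?add0r ?addr0; ring.
rewrite (@ge0_continuous_FTC2y _ _ (fun l : R => - expR (- (l * s)))%R 1%R 0%R).
- by rewrite mul1r sub0e EFinN oppeK.
- by move=> x _; rewrite mulr_ge0 ?expR_ge0 ?ltW.
- apply: continuous_in_subspaceT => x _.
  apply: differentiable_continuous.
  by apply/derivable1_diffP; exact: ex_derive.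
- rewrite -oppr0; apply: cvgN.
  apply: (@cvg_comp _ _ _ (fun l : R => l * s)%R (fun z : R => expR (- z))
    _ (pinfty_nbhs R)); last exact: cvgr_expR.
  exact: gt0_cvgMly.
- by move=> x x1; have [] := dF x.
- apply: cvg_at_right_filter.
  by apply: (@differentiable_continuous R R^o R^o _ (fun l : R => - expR (- (l *
    s)))%R); apply/derivable1_diffP; have [] := dF 1%R.
- move=> x _; rewrite derive1E.
  by have [_ ->] := dF x.
Qed.
End FTC.

(** * A moment recursion for homogeneous functions *)

Section recursion.
Context {R : realType}.
Local Notation mu := (@lebesgue_measure R).
Local Open Scope ereal_scope.

(* Integrate [(x + y) / 2 * h * expR (- l * (x + y) / 2)] over [1 <= l]: in [l]
   first this gives the right-hand side, and in [(x, y)] first, the dilation by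
   [l] extracts the factor [l `^ (- (al + 3))]. *)
Lemma homogeneous_integral_rec (h : R * R -> R) (al : R) : (0 < al + 2)%R ->
  measurable_fun setT h -> (forall z, 0 <= h z)%R ->
  (forall z, h z != 0 -> 0 < z.1 /\ 0 < z.2)%R ->
  (forall c z, 0 < c -> h (c * z.1, c * z.2) = c `^ al * h z)%R ->
  \int[leb2]_z ((z.1 + z.2) * (h z * expR (- ((z.1 + z.2) / 2))))%:E =
  (2 * (al + 2))%:E * \int[leb2]_z (h z * expR (- ((z.1 + z.2) / 2)))%:E.
Proof.
move=> al2 mh h0 hpos hhom.
pose s (z : R * R) : R := ((z.1 + z.2) / 2)%R.
have ms : measurable_fun setT s by apply: measurable_funM => //; apply: measurable_funD.
pose H (l : R) (z : R * R) : R := (s z * (h z * expR (- (l * s z))))%R.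
have H0 l z : (0 <= H l z)%R.
  have [hz|/hpos[x0 y0]] := eqVneq (h z) 0%R; first by rewrite /H hz mul0r mulr0.
  by rewrite /H !mulr_ge0 ?expR_ge0 ?divr_ge0 ?addr_ge0// ltW.
have mH2 : measurable_fun setT (fun u : R * (R * R) => H u.1 u.2).
  apply: measurable_funM; first exact: (measurableT_comp ms).
  apply: measurable_funM; first exact: (measurableT_comp mh).
  apply: measurableT_comp => //; apply: measurable_funN.
  by apply: measurable_funM => //; exact: (measurableT_comp ms).
have mH l : measurable_fun setT (H l).
  exact: (measurableT_comp mH2 (pair1_measurable l)).
(* Extending the integrand by 0 for [l < 1] allows Tonelli on the whole product space. *)
pose K (u : R * (R * R)) : \bar R := (if (1 <= u.1)%R then H u.1 u.2 else 0)%:E.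
have K0 u : 0 <= K u by rewrite /K lee_fin; case: ifP.
have mK : measurable_fun setT K.
  apply/measurable_EFinP; apply: measurable_fun_ifT => //.
  exact: measurable_fun_ler.
have := @fubini_tonelli _ _ (measurableTypeR R)
  (measurableTypeR R * measurableTypeR R)%type R mu leb2 K mK K0.
have onl (f : R -> R) : \int[mu]_l (if (1 <= l)%R then f l else 0)%:E =
    \int[mu]_(l in `[1%R, +oo[) (f l)%:E.
  rewrite [RHS]integral_mkcond; apply: eq_integral => l _.
  by rewrite patchE mem_setE in_itv/= andbT; case: ifP.
rewrite /K/=.
rewrite (_ : \int[leb2]_z _ = \int[leb2]_z (h z * expR (- s z))%:E); last first.
  apply: eq_integral => z _; rewrite onl.
  have [hz|/hpos[x0 y0]] := eqVneq (h z) 0%R.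
    by rewrite hz mul0r integral0_eq// => l _; rewrite /H hz mul0r mulr0.
  have sz : (0 < s z)%R by rewrite divr_gt0 ?addr_gt0.
  under eq_integral do rewrite /H mulrCA EFinM.
  rewrite ge0_integralZl//=.
  - by rewrite integral_expR_1y.
  - apply/measurable_EFinP/measurable_funTS.
    apply: measurable_funM => //; apply: measurableT_comp => //.
    by apply: measurable_funN; apply: measurable_funM.
  - by move=> l _; rewrite lee_fin mulr_ge0 ?expR_ge0 ?ltW.
  - by rewrite lee_fin.
move=> <-.
(* Dilating by [l] produces [l ^+ 2] from the area, [l] from [s] and [l ^ al] from [h], hence the
   exponent [al + 3]. *)
have scale l : (1 <= l)%R -> \int[leb2]_z (H l z)%:E =
    (l `^ (- (al + 2 + 1)))%:E * \int[leb2]_z (H 1%R z)%:E.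
  move=> l1; have l0 : (0 < l)%R by exact: lt_le_trans l1.
  rewrite (@ge0_integral_dilation2 _ l (fun z => (H 1%R z)%:E))//; last first.
  - by move=> z; rewrite lee_fin.
  - exact/measurable_EFinP.
  rewrite -ge0_integralZl//; last first.
  - by rewrite lee_fin sqr_ge0.
  - by move=> z _; rewrite lee_fin.
  - apply/measurable_EFinP; apply: (measurableT_comp (mH 1%R)).
    by apply/measurable_fun_pairP; split; apply: measurable_funM.
  rewrite -ge0_integralZl//; last first.
  - by rewrite lee_fin powR_ge0.
  - by move=> z _; rewrite -EFinM lee_fin mulr_ge0 ?sqr_ge0.
  - apply/measurable_EFinP; apply: measurable_funM => //.
    apply: (measurableT_comp (mH 1%R)).
    by apply/measurable_fun_pairP; split; apply: measurable_funM.
  apply: eq_integral => z _; rewrite -!EFinM; congr (_%:E).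
  rewrite /H hhom//.
  have -> : s (l * z.1, l * z.2)%R = (l * s z)%R by rewrite /s/=; ring.
  have e : (l `^ (- (al + 2 + 1)) * (l ^+ 2 * (l * l `^ al)) = 1)%R.
    rewrite powRN -addrA powRD; last by apply/implyP => _; rewrite gt_eqF.
    rewrite -natr1 -(natrD _ 2 1) powR_mulrn ?ltW//.
    have := powR_gt0 al l0; set q := (_ `^ _)%R => q0.
    by field; rewrite !gt_eqF.
  rewrite mul1r -[LHS]mul1r -[X in (X * _)%R = _]e; ring.
rewrite (_ : \int[mu]_l _ = \int[mu]_l
    ((if (1 <= l)%R then l `^ (- (al + 2 + 1))
      else 0)%R%:E * \int[leb2]_z (H 1%R z)%:E)); last first.
  apply: eq_integral => l _.
  by case: ifPn => [/scale//|_]; rewrite integral0 mul0e.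
rewrite ge0_integralZr//=; last first.
- by apply: integral_ge0 => z _; rewrite lee_fin.
- by move=> l _; rewrite lee_fin; case: ifP => // _; exact: powR_ge0.
- apply/measurable_EFinP; apply: measurable_fun_ifT => //.
  exact: measurable_fun_ler.
(* The integral over [l] is [(al + 2)^-1], which cancels against [2 * (al + 2)]; the remaining 2
   undoes the halving in [s]. *)
rewrite (onl (fun l => l `^ (- (al + 2 + 1)))%R) integral_powR_1y// muleA -EFinM.
rewrite -mulrA divff ?gt_eqF// mulr1 -ge0_integralZl//.
- apply: eq_integral => z _; rewrite -EFinM; congr (_%:E).
  rewrite /H /s mul1r; by field.
- by apply/measurable_EFinP; exact: (mH 1%R).
- by move=> z _; rewrite lee_fin.
Qed.
End recursion.

(** * Measures with a density *)

Section density_measure.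
Local Open Scope ereal_scope.
Context d (T : measurableType d) (R : realType).
Variables (mu : {measure set T -> \bar R}) (f : T -> R).
Variables (mf : measurable_fun setT f) (f0 : forall x, (0 <= f x)%R).

(* [mf] and [f0] occur in the term so that the measure structure is inferred. *)
Definition density_measure of measurable_fun setT f & (forall x, (0 <= f x)%R) :=
  fun A : set T => \int[mu]_(x in A) (f x)%:E.

Local Notation nu := (density_measure mf f0).

Let nu0 : nu set0 = 0. Proof. by rewrite /density_measure integral_set0. Qed.

Let nu_ge0 A : 0 <= nu A.
Proof. by apply: integral_ge0 => x _; rewrite lee_fin. Qed.

Let nu_sigma_additive : semi_sigma_additive nu.
Proof.
move=> F mF tF mUF; rewrite /density_measure ge0_integral_bigcup//=.
- apply: is_cvg_ereal_nneg_natsum_cond => n _ _.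
  by apply: integral_ge0 => x _; rewrite lee_fin.
- exact/measurable_EFinP/measurable_funTS.
- by move=> x _; rewrite lee_fin.
Qed.

HB.instance Definition _ := isMeasure.Build _ _ _ nu nu0 nu_ge0 nu_sigma_additive.

Import HBNNSimple.

Let mfE : measurable_fun setT (EFin \o f).
Proof. exact/measurable_EFinP. Qed.

Let integral_density_nnsfun (h : {nnsfun T >-> R}) :
  \int[nu]_x (h x)%:E = \int[mu]_x ((h x)%:E * (f x)%:E).
Proof.
under [LHS]eq_integral do rewrite fimfunE -fsumEFin//.
rewrite [LHS]ge0_integral_fsum//; last 2 first.
  - by move=> r; exact/measurable_EFinP/measurableT_comp.
  - by move=> n x _; rewrite EFinM nnfun_muleindic_ge0.
under [RHS]eq_integral.
  move=> x _; rewrite fimfunE -fsumEFin// ge0_mule_fsuml; last first.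
    by move=> r; rewrite EFinM nnfun_muleindic_ge0.
  over.
rewrite [RHS]ge0_integral_fsum//; last 2 first.
  - move=> r; apply: emeasurable_funM => //.
    exact/measurable_EFinP/measurableT_comp.
  - by move=> n x _; rewrite EFinM mule_ge0 ?nnfun_muleindic_ge0// lee_fin.
(* A nonnegative simple function takes no negative value, so for [r < 0] the indicator vanishes on
   both sides. *)
apply: eq_fsbigr => r _; have [r0|r0] := leP 0%R r; last first.
  by rewrite !integral0_eq// => x _;
    rewrite preimage_nnfun0// indicE in_set0 mulr0// mul0e.
under eq_integral do rewrite EFinM.
under [RHS]eq_integral do rewrite EFinM -muleA.
rewrite ge0_integralZl//; last exact/measurable_EFinP.
rewrite ge0_integralZl//; last 2 first.
- by apply: emeasurable_funM => //; exact/measurable_EFinP.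
- by move=> x _; rewrite -EFinM lee_fin mulr_ge0.
congr (_ * _); rewrite integral_indic// setIT /= /density_measure integral_mkcond.
apply: eq_integral => x _; rewrite patchE indicE.
by case: (x \in _); rewrite ?mul1e ?mul0e.
Qed.

(** Linearity gives the identity for simple functions, and monotone convergence passes to the
    limit. *)
Lemma ge0_integral_density (g : T -> \bar R) :
  measurable_fun setT g -> (forall x, 0 <= g x) ->
  \int[nu]_x g x = \int[mu]_x (g x * (f x)%:E).
Proof.
move=> mg g0; pose g_ := nnsfun_approx measurableT mg.
transitivity (limn (fun n => \int[nu]_x (g_ n x)%:E)).
  rewrite -monotone_convergence//=.
  - apply: eq_integral => x _; apply/esym/cvg_lim => //=.
    exact: cvg_nnsfun_approx.
  - by move=> n; exact/measurable_EFinP.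
  - by move=> n x _; rewrite lee_fin.
  - by move=> x _ a b ab; rewrite lee_fin//; exact/lefP/nd_nnsfun_approx.
under eq_fun do rewrite integral_density_nnsfun.
rewrite -monotone_convergence//=.
- apply: eq_integral => x _; apply/cvg_lim => //=.
  by apply: cvgeMr => //; exact: cvg_nnsfun_approx.
- by move=> n; apply: emeasurable_funM => //; exact/measurable_EFinP.
- by move=> n x _; rewrite -EFinM lee_fin mulr_ge0.
- move=> x _ a b ab; rewrite lee_wpmul2r ?lee_fin//.
  exact/lefP/nd_nnsfun_approx.
Qed.

End density_measure.

(** * The law of (S1, S2) *)

Section chi2.
Context {R : realType}.

Lemma measurable_pos : measurable [set t : R | 0 < t].
Proof.
rewrite (_ : [set t | _] = `]0, +oo[%classic)//.
by apply/seteqP; split => t /=; rewrite in_itv/= andbT.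
Qed.

(** Inversion is discontinuous at 0, so it is glued from power functions on the two half-lines and
    the value [0^-1 = 0]. *)
Lemma measurable_invr : measurable_fun setT (@GRing.inv R).
Proof.
pose g (x : R) : R :=
  if 0 < x then x `^ (-1) else if x < 0 then - (- x) `^ (-1) else 0.
rewrite (_ : GRing.inv = g); last first.
  apply/funext => x; rewrite /g; case: ltrgt0P => [x0|x0|->].
  - by rewrite powR_inv1// ltW.
  - by rewrite powR_inv1 ?invrN ?opprK// oppr_ge0 ltW.
  - by rewrite invr0.
apply: measurable_fun_ifT.
- exact: measurable_fun_ltr.
- exact: measurable_powR.
apply: measurable_fun_ifT => //.
- exact: measurable_fun_ltr.
- apply: measurable_funN; apply: (measurableT_comp (measurable_powR (-1))).
  exact: measurable_funN.
Qed.

Lemma measurable_fun_div d (T : measurableType d) (f g : T -> R) :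
  measurable_fun setT f -> measurable_fun setT g ->
  measurable_fun setT (fun x => f x / g x).
Proof.
move=> mf mg; apply: measurable_funM => //.
exact: (measurableT_comp measurable_invr).
Qed.

Lemma Gamma_fun_ge0 (a : R) : 0 <= Gamma_fun a.
Proof.
by apply: Rintegral_ge0 => x _; rewrite mulr_ge0 ?powR_ge0 ?expR_ge0.
Qed.

Lemma chi2_pdf_ge0 m (x : R) : 0 <= chi2_pdf m x.
Proof.
rewrite /chi2_pdf; case: ifP => // _.
by rewrite divr_ge0 ?mulr_ge0 ?powR_ge0 ?expR_ge0 ?Gamma_fun_ge0.
Qed.

Lemma measurable_chi2_pdf m : measurable_fun setT (@chi2_pdf R m).
Proof.
apply: measurable_fun_ifT => //; first exact: measurable_fun_ltr.
apply: measurable_funM => //; apply: measurable_funM.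
  exact: measurable_powR.
apply: measurableT_comp => //; apply: measurable_funN.
exact: measurable_funM.
Qed.

Definition chi2_pdf2 m1 m2 (z : R * R) : R := chi2_pdf m1 z.1 * chi2_pdf m2 z.2.

Lemma chi2_pdf2_ge0 m1 m2 z : 0 <= chi2_pdf2 m1 m2 z.
Proof. by rewrite mulr_ge0 ?chi2_pdf_ge0. Qed.

Lemma measurable_chi2_pdf2 m1 m2 : measurable_fun setT (chi2_pdf2 m1 m2).
Proof.
apply: measurable_funM.
  exact: (measurableT_comp (measurable_chi2_pdf m1)).
exact: (measurableT_comp (measurable_chi2_pdf m2)).
Qed.

Lemma iso_normal_boxT n (th : 'rV[R]_n) (v : R) :
  iso_normal_box th v (fun=> setT) = 1%E.
Proof.
rewrite /iso_normal_box big1// => i _.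
by rewrite /normal_prob integral_normal_pdf.
Qed.

(** Moving the scale into the indicator leaves a single density for all values of [tau], as Tonelli
    over [(t, z)] requires. *)
Lemma scaled_chi2_probE m (v : R) (B : set R) :
  scaled_chi2_prob m v B =
  (\int[lebesgue_measure]_x (\1_B (v * x) * chi2_pdf m x)%:E)%E.
Proof.
rewrite /scaled_chi2_prob /chi2_prob integral_mkcond; apply: eq_integral => x _.
rewrite patchE indicE /=.
have -> : (x \in [set y | B (v * y)]) = (v * x \in B) by apply/idP/idP; rewrite !inE.
by case: (_ \in B); rewrite ?mul1r ?mul0r.
Qed.

End chi2.

Lemma ge0_integral_leb2M {R : realType} (a b : R -> R) :
  measurable_fun setT a -> measurable_fun setT b ->
  (forall x, 0 <= a x) -> (forall x, 0 <= b x) ->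
  (\int[leb2]_z (a z.1 * b z.2)%:E =
   \int[lebesgue_measure]_x (a x)%:E * \int[lebesgue_measure]_y (b y)%:E)%E.
Proof.
move=> ma mb a0 b0; rewrite ge0_integral_leb2.
- rewrite -ge0_integralZr//.
  + apply: eq_integral => x _ /=; under eq_integral do rewrite EFinM.
    rewrite ge0_integralZl//.
    * exact/measurable_EFinP.
    * by move=> y _; rewrite lee_fin.
    * by rewrite lee_fin.
  + exact/measurable_EFinP.
  + by move=> x _; rewrite lee_fin.
  + by apply: integral_ge0 => y _; rewrite lee_fin.
- apply/measurable_EFinP/measurable_funM.
  + exact: (measurableT_comp ma).
  + exact: (measurableT_comp mb).
- by move=> z; rewrite lee_fin mulr_ge0.
Qed.

(** * From the conditional law to expectations of functions of (S1, S2) *)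

Section transfer.
Context (R : realType) (p q m1 m2 : nat) (Pi : probability R R)
  (d : measure_display) (T : measurableType d) (P : probability T R)
  (tau : T -> R) (X1 : T -> 'rV[R]_p) (S1 : T -> R)
  (X2 : T -> 'rV[R]_q) (S2 : T -> R) (w : param R p q).
Hypothesis Pi_pos : Pi [set t : R | 0 < t] = 1%E.
Hypothesis model : scale_mixture_model m1 m2 Pi P tau X1 S1 X2 S2 w.
Local Open Scope ereal_scope.

Let mS : measurable_fun setT (fun x => (S1 x, S2 x)).
Proof.
by apply/measurable_fun_pairP; split; [exact: (meas_S1 model)|exact: (meas_S2 model)].
Qed.

Local Notation v1 t := (sigma1 w ^+ 2 / t)%R.
Local Notation v2 t := (sigma2 w ^+ 2 / t)%R.

(** The law of [(S1, S2)] and the image under [Phi] of the measure with density [k] with respect to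
    [Pi \x leb2] agree on rectangles. These form a pi-system generating the Borel sets of the plane,
    so the two laws coincide. *)
Lemma ge0_expectation_S1S2 (f : R * R -> \bar R) :
  measurable_fun setT f -> (forall z, 0 <= f z) ->
  \int[P]_x f (S1 x, S2 x) =
  \int[Pi]_(t in [set t | (0 < t)%R])
    \int[leb2]_z (f (v1 t * z.1, v2 t * z.2)%R * (chi2_pdf2 m1 m2 z)%:E).
Proof.
move=> mf f0.
have mpos := @measurable_pos R.
pose U := (R * (measurableTypeR R * measurableTypeR R))%type.
pose Phi (u : R * (R * R)) : R * R := (v1 u.1 * u.2.1, v2 u.1 * u.2.2)%R.
have m1v : measurable_fun setT (fun u : R * (R * R) => (u.1)^-1%R : R).
  exact: (measurableT_comp measurable_invr).
have mPhi : measurable_fun setT Phi.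
  apply/measurable_fun_pairP; split; apply: measurable_funM => //;
    try apply: measurable_funM => //; exact: measurableT_comp.
have mI (B : set R) : measurable B -> measurable_fun setT (\1_B : R -> R).
  by move=> mB; exact: measurable_indic.
pose k (u : R * (R * R)) : R := chi2_pdf2 m1 m2 u.2.
have mk : measurable_fun setT k by exact: (measurableT_comp (measurable_chi2_pdf2 m1 m2)).
have k0 u : (0 <= k u)%R by exact: chi2_pdf2_ge0.
pose base : {measure set _ -> \bar R} := Pi \x leb2.
pose nu : {measure set _ -> \bar R} := density_measure base mk k0.
have -> : \int[Pi]_(t in [set t | (0 < t)%R]) \int[leb2]_z
    (f (v1 t * z.1, v2 t * z.2)%R * (chi2_pdf2 m1 m2 z)%:E) = \int[nu]_u f (Phi u).
  pose Fk u := f (Phi u) * (k u)%:E.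
  have mFk : measurable_fun setT Fk.
    apply: emeasurable_funM; first exact: measurableT_comp.
    exact/measurable_EFinP.
  have Fk0 u : 0 <= Fk u by rewrite mule_ge0// lee_fin.
  (* The values [t <= 0] form a null set for [Pi]. *)
  transitivity (\int[Pi]_t \int[leb2]_z Fk (t, z)).
    rewrite (@ge0_negligible_integral _ _ _ Pi setT (~` [set t | (0 < t)%R]))//.
    - by rewrite setTD setCK.
    - exact: measurableC.
    - exact: (measurable_fun_fubini_tonelli_F (m2 := leb2) Fk mFk Fk0).
    - by move=> t _; exact: integral_ge0.
    - by rewrite [LHS]probability_setC// Pi_pos subee.
  rewrite ge0_integral_density//; last exact: measurableT_comp.
  by rewrite [RHS]fubini_tonelli1.
have eP := ge0_integral_pushforward mS P measurableT mf (fun z _ => f0 z).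
rewrite preimage_setT in eP; rewrite -[LHS]eP.
(* The same map, with its domain typed as the space that carries [nu]. *)
have mPhi' : measurable_fun (setT : set U) Phi by exact: mPhi.
have enu := ge0_integral_pushforward mPhi' nu measurableT mf (fun z _ => f0 z).
rewrite preimage_setT in enu; rewrite -[RHS]enu.
apply: eq_measure_integral => A mA _.
pose G : set (set (R * R)) :=
  [set B1 `*` B2 | B1 in measurable & B2 in measurable].
apply: (measure_unique G (fun=> setT)) mA => //.
- exact: measurable_prod_measurableType.
- move=> _ _ [B1 mB1 [B2 mB2 <-]] [C1 mC1 [C2 mC2 <-]]; rewrite -setXI.
  exists (B1 `&` C1); first exact: measurableI.
  by exists (B2 `&` C2) => //; exact: measurableI.
- by move=> _; exists setT => //; exists setT => //; rewrite setXTT.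
- by rewrite bigcup_const.
- move=> _ [B1 mB1 [B2 mB2 <-]]; rewrite /= /pushforward.
  (* Whole-space sets for [tau], [X1] and [X2] leave the joint law of [S1] and [S2]. *)
  have := cond_law model measurableT mB1 mB2 (fun=> measurableT) (fun=> measurableT).
  rewrite (_ : [set x | _] = (fun x => (S1 x, S2 x)) @^-1` (B1 `*` B2)); last first.
    by apply/seteqP; split => x /= [].
  move=> ->; rewrite /density_measure integral_mkcond.
  rewrite [RHS]fubini_tonelli1//.
  (* The integrands agree at every [t], whatever its sign. *)
  + apply: eq_integral => t _; rewrite !iso_normal_boxT mul1e mule1.
    rewrite /fubini_F !scaled_chi2_probE -ge0_integral_leb2M//.
    * apply: eq_integral => z _; rewrite patchE/= /k /chi2_pdf2 !indicE.
      have -> : ((t, z) \in Phi @^-1` (B1 `*` B2)) =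
          ((v1 t * z.1)%R \in B1) && ((v2 t * z.2)%R \in B2).
        by apply/idP/andP; rewrite !inE.
      by case: (_ \in B1); case: (_ \in B2); rewrite /= ?mul1r ?mul0r ?mulr0.
    * apply: measurable_funM; last exact: measurable_chi2_pdf.
      apply: (measurableT_comp (mI _ mB1)).
      exact: measurable_funM.
    * apply: measurable_funM; last exact: measurable_chi2_pdf.
      apply: (measurableT_comp (mI _ mB2)).
      exact: measurable_funM.
    * by move=> x; rewrite mulr_ge0 ?chi2_pdf_ge0.
    * by move=> x; rewrite mulr_ge0 ?chi2_pdf_ge0.
  + apply/(measurable_restrictT _ _).1 => //.
      by rewrite -[X in measurable X]setTI; apply: mPhi' => //; exact: measurableX.
    exact/measurable_EFinP/measurable_funTS.
  + by move=> u; rewrite patchE; case: ifP => // _; rewrite lee_fin.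
- by move=> _; exact: (le_lt_trans (probability_le1 P measurableT) (ltry 1)).
Qed.

End transfer.

(** * Independence of the ratio and the sum of two chi-squared variables *)

Section radial.
Context {R : realType} (m1 m2 : nat).
Hypothesis (m1_gt0 : (0 < m1)%N).
Implicit Types (g : R -> R) (z : R * R).

(** For independent chi-squared [Y1], [Y2] this is the expectation of
    [g (r * (Y1 / Y2)) * (Y1 + Y2) ^+ k]. With [r = sigma1^2 / sigma2^2], the argument of [g] stands
    for [Z] and [Y1 + Y2] for [tau W]. *)
Definition ratio_integral (g : R -> R) (r : R) (k : nat) : \bar R :=
  (\int[leb2]_z (g (r * (z.1 / z.2)) * (z.1 + z.2) ^+ k * chi2_pdf2 m1 m2 z)%:E)%E.

Local Notation a1 := (m1%:R / 2 - 1 : R).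
Local Notation a2 := (m2%:R / 2 - 1 : R).
Local Notation C := ((2 `^ (m1%:R / 2) * Gamma_fun (m1%:R / 2))^-1 *
    (2 `^ (m2%:R / 2) * Gamma_fun (m2%:R / 2))^-1 : R).

(** Separates a factor homogeneous of degree [a1 + a2] from an exponential in [z.1 + z.2], the shape
    that [homogeneous_integral_rec] treats. *)
Lemma chi2_pdf2E z : chi2_pdf2 m1 m2 z =
  (if (0 < z.1) && (0 < z.2) then z.1 `^ a1 * z.2 `^ a2 * C else 0) *
  expR (- ((z.1 + z.2) / 2)).
Proof.
rewrite /chi2_pdf2 /chi2_pdf.
case: (ltP 0 z.1) => z1; last by rewrite !mul0r.
case: (ltP 0 z.2) => z2; last by rewrite mulr0 mul0r.
rewrite (_ : - ((z.1 + z.2) / 2) = - (z.1 / 2) + - (z.2 / 2)); last by ring.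
by rewrite /= expRD; ring.
Qed.

Lemma chi2_pdf2_neq0 z : chi2_pdf2 m1 m2 z != 0 -> 0 < z.1 /\ 0 < z.2.
Proof.
rewrite chi2_pdf2E; case: ifPn => [/andP[]//|_].
by rewrite mul0r eqxx.
Qed.

(** The ratio is invariant under dilations, so [g] adds nothing to the degree [al = a1 + a2 + k] of
    the homogeneous factor, and [2 * (al + 2) = m1 + m2 + 2 * k]. *)
Lemma ratio_integralS g r k : measurable_fun setT g -> (forall x, 0 <= g x) ->
  ratio_integral g r k.+1 = ((m1 + m2 + 2 * k)%:R%:E * ratio_integral g r k)%E.
Proof.
move=> mg g0.
pose h z : R := if (0 < z.1) && (0 < z.2) then
  g (r * (z.1 / z.2)) * (z.1 + z.2) ^+ k * (z.1 `^ a1 * z.2 `^ a2 * C) else 0.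
have hE (z : R * R) : g (r * (z.1 / z.2)) * (z.1 + z.2) ^+ k * chi2_pdf2 m1 m2 z =
    h z * expR (- ((z.1 + z.2) / 2)).
  rewrite chi2_pdf2E /h; case: ifP => _; last by rewrite !mul0r mulr0.
  by rewrite mulrA.
have C0 : 0 <= C by rewrite mulr_ge0// invr_ge0 mulr_ge0 ?powR_ge0 ?Gamma_fun_ge0.
pose al : R := a1 + a2 + k%:R.
have al2 : al + 2 = (m1 + m2 + 2 * k)%:R / 2 by rewrite /al (natrD _ (m1 + m2))
  natrM natrD; by field.
have -> : (m1 + m2 + 2 * k)%:R = 2 * (al + 2) :> R by rewrite al2; by field.
rewrite /ratio_integral; under [in RHS]eq_integral do rewrite hE.
rewrite -homogeneous_integral_rec.
- apply: eq_integral => z _; rewrite -hE exprS; congr (_%:E); ring.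
- by rewrite al2 divr_gt0// ltr0n addn_gt0 addn_gt0 m1_gt0.
- apply: measurable_fun_ifT => //.
    by apply: measurable_and; apply: measurable_fun_ltr.
  apply: measurable_funM.
    apply: measurable_funM.
      apply: (measurableT_comp mg); apply: measurable_funM => //.
      exact: measurable_fun_div.
    by apply: measurable_funX; exact: measurable_funD.
  apply: measurable_funM => //; apply: measurable_funM.
    exact: (measurableT_comp (measurable_powR a1)).
  exact: (measurableT_comp (measurable_powR a2)).
- move=> z; rewrite /h; case: ifP => // /andP[z1 z2].
  apply: mulr_ge0; apply: mulr_ge0 => //.
    by rewrite exprn_ge0 ?addr_ge0 ?ltW.
  by rewrite mulr_ge0 ?powR_ge0.
- by move=> z; rewrite /h; case: ifPn => [/andP[]//|]; rewrite eqxx.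
- move=> c z c0; rewrite /h /= !pmulr_rgt0//; case: ifPn => [/andP[z1 z2]|_];
    last by rewrite mulr0.
  rewrite -mulf_div divff ?gt_eqF// mul1r -mulrDr exprMn !powRM ?ltW//.
  have cD u v : c `^ (u + v) = c `^ u * c `^ v by apply: powRD; rewrite (gt_eqF c0);
    apply: implybT.
  by rewrite /al !cD powR_mulrn ?ltW//; ring.
Qed.

Lemma ratio_integral1 g r : measurable_fun setT g -> (forall x, 0 <= g x) ->
  ratio_integral g r 1 = ((m1 + m2)%:R%:E * ratio_integral g r 0)%E.
Proof. by move=> mg g0; rewrite ratio_integralS// muln0 addn0. Qed.

Lemma ratio_integral2 g r : measurable_fun setT g -> (forall x, 0 <= g x) ->
  ratio_integral g r 2 = (((m1 + m2 + 2) * (m1 + m2))%:R%:E * ratio_integral g r 0)%E.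
Proof.
by move=> mg g0; rewrite ratio_integralS// ratio_integral1// muleA -EFinM natrM.
Qed.
End radial.

Lemma integral_full_set d (T : measurableType d) (R : realType)
    (mu : {measure set T -> \bar R}) (D : set T) (f : T -> \bar R) :
  measurable D -> mu (~` D) = 0%E -> measurable_fun setT f ->
  (\int[mu]_x f x = \int[mu]_(x in D) f x)%E.
Proof.
move=> mD D0 mf; rewrite [RHS]integral_mkcond; apply: ae_eq_integral => //.
- by apply/(measurable_restrictT _ _).1 => //; exact: measurable_funTS.
- exists (~` D); split => //; first exact: measurableC.
  by move=> x /= xN Dx; apply: xN => _; rewrite patchE mem_set.
Qed.

(** If the integral were 0, [f] would vanish off a null set, which would then contain [A]. *)
Lemma ge0_integral_gt0 d (T : measurableType d) (R : realType)
    (mu : {measure set T -> \bar R}) (f : T -> \bar R) (A : set T) :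
  measurable_fun setT f -> (forall x, 0 <= f x)%E -> measurable A ->
  (0 < mu A)%E -> (forall x, A x -> 0 < f x)%E -> (0 < \int[mu]_x f x)%E.
Proof.
move=> mf f0 mA A0 fA; rewrite lt0e integral_ge0// andbT; apply/eqP => f_eq0.
have : (\int[mu]_x `|f x| = 0)%E.
  by rewrite -[RHS]f_eq0; apply: eq_integral => x _; rewrite gee0_abs.
move=> /(ae_eq_integral_abs mu measurableT mf)[N [mN N0 fN]].
have AN : A `<=` N.
  by move=> x Ax; apply: fN => /= /(_ I) fx; have := fA x Ax; rewrite fx ltxx.
have : (mu A <= mu N)%E by apply: le_measure; rewrite ?inE.
by rewrite N0 leNgt A0.
Qed.

(** * Inverse moments of the mixing variable *)

Section inv_moment.
Context {R : realType} (Pi : probability R R).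
Hypothesis Pi_pos : Pi [set t : R | 0 < t] = 1%E.
Local Open Scope ereal_scope.

Lemma measurable_invX k : measurable_fun setT (fun t : R => (t ^- k)%R).
Proof.
exact: (measurableT_comp measurable_invr (measurable_funX k (measurable_id (D := setT)))).
Qed.

Lemma inv_momentE k :
  inv_moment Pi k = \int[Pi]_(t in [set t | (0 < t)%R]) (t ^- k)%:E.
Proof.
have mpos := @measurable_pos R.
have mk : measurable_fun setT (fun t : R => (t ^- k)%:E).
  by apply/measurable_EFinP; exact: measurable_invX.
rewrite /inv_moment unlock; apply: integral_full_set => //.
by rewrite [LHS]probability_setC// Pi_pos subee.
Qed.

Lemma inv_moment_gt0 k : 0 < inv_moment Pi k.
Proof.
have mpos := @measurable_pos R.
rewrite inv_momentE integral_mkcond.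
apply: (@ge0_integral_gt0 _ _ _ Pi ((fun t => (t ^- k)%:E) \_ [set t | (0 < t)%R])
  [set t | (0 < t)%R]) => //.
- apply/(measurable_restrictT _ _).1 => //.
  by apply: measurable_funTS; apply/measurable_EFinP; exact: measurable_invX.
- move=> t; rewrite patchE; case: ifPn => //; rewrite inE/= => t0.
  by rewrite lee_fin invr_ge0 exprn_ge0 ?ltW.
- by rewrite [ltRHS]Pi_pos.
- by move=> t t0; rewrite patchE mem_set// lte_fin invr_gt0 exprn_gt0.
Qed.

End inv_moment.

(** * The joint behaviour of Z and W in the model *)

Section model.
Context (R : realType) (p q m1 m2 : nat) (Pi : probability R R)
  (d : measure_display) (T : measurableType d) (P : probability T R)
  (tau : T -> R) (X1 : T -> 'rV[R]_p) (S1 : T -> R)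
  (X2 : T -> 'rV[R]_q) (S2 : T -> R) (w : param R p q).
Hypothesis Pi_pos : Pi [set t : R | 0 < t] = 1%E.
Hypothesis aw : admissible w.
Hypothesis model : scale_mixture_model m1 m2 Pi P tau X1 S1 X2 S2 w.
Local Open Scope ereal_scope.

Local Notation r := (sigma1 w ^+ 2 / sigma2 w ^+ 2)%R.
Local Notation W x := (S1 x / sigma1 w ^+ 2 + S2 x / sigma2 w ^+ 2)%R.
Local Notation v1 t := (sigma1 w ^+ 2 / t)%R.
Local Notation v2 t := (sigma2 w ^+ 2 / t)%R.

Let s1_gt0 : (0 < sigma1 w ^+ 2)%R.
Proof. by case: aw => s1 _ _; rewrite exprn_gt0. Qed.

Let s2_gt0 : (0 < sigma2 w ^+ 2)%R.
Proof. by case: aw => _ s2 _; rewrite exprn_gt0. Qed.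

(** Given [tau = t], [S1 = v1 t * Y1] and [S2 = v2 t * Y2], so [Z = r * (Y1 / Y2)] is free of [t]
    and [W = (Y1 + Y2) / t]; hence [t ^- k] factors out. The absolute value makes the integrand
    nonnegative everywhere, not just almost surely. *)
Lemma ge0_expectation_ratio (g : R -> R) k :
  measurable_fun setT g -> (forall x, (0 <= g x)%R) ->
  \int[P]_x (g (S1 x / S2 x) * `|W x| ^+ k)%:E =
  inv_moment Pi k * ratio_integral m1 m2 g r k.
Proof.
move=> mg g0.
pose f (z : R * R) : R :=
  (g (z.1 / z.2) * `|z.1 / sigma1 w ^+ 2 + z.2 / sigma2 w ^+ 2| ^+ k)%R.
have mf : measurable_fun setT f.
  apply: measurable_funM.
    by apply: (measurableT_comp mg); exact: measurable_fun_div.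
  apply: measurable_funX; apply: measurableT_comp => //.
  by apply: measurable_funD; apply: measurable_funM.
have f0 z : (0 <= f z)%R by rewrite mulr_ge0// exprn_ge0.
rewrite (@ge0_expectation_S1S2 _ _ _ _ _ _ _ _ _ _ _ _ _ _ _ Pi_pos model (EFin \o
  f)); last 2 first.
- by apply/measurable_EFinP.
- by move=> z /=; rewrite lee_fin.
pose G (z : R * R) : R := (g (r * (z.1 / z.2)) * (z.1 + z.2) ^+ k * chi2_pdf2 m1 m2 z)%R.
have G0 z : (0 <= G z)%R.
  rewrite /G; have [->|/chi2_pdf2_neq0[z1 z2]] := eqVneq (chi2_pdf2 m1 m2 z) 0%R.
    by rewrite mulr0.
  apply: mulr_ge0; last exact: chi2_pdf2_ge0.
  by rewrite mulr_ge0// exprn_ge0// addr_ge0 ?ltW.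
have mG : measurable_fun setT G.
  apply: measurable_funM; last exact: measurable_chi2_pdf2.
  apply: measurable_funM.
    apply: (measurableT_comp mg); apply: measurable_funM => //.
    exact: measurable_fun_div.
  by apply: measurable_funX; exact: measurable_funD.
rewrite inv_momentE// -ge0_integralZr//; last 4 first.
- exact: measurable_pos.
- by apply/measurable_EFinP; apply: measurable_funTS; exact: measurable_invX.
- by move=> t t0; rewrite lee_fin invr_ge0 exprn_ge0 ?ltW.
- by apply: integral_ge0 => z _; rewrite lee_fin; exact: G0.
apply: eq_integral => t; rewrite inE/= => t0.
rewrite -ge0_integralZl//; last 3 first.
- by apply/measurable_EFinP; exact: mG.
- by move=> z _; rewrite lee_fin; exact: G0.
- by rewrite lee_fin invr_ge0 exprn_ge0 ?ltW.
apply: eq_integral => z _ /=; rewrite -!EFinM; congr (_%:E).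
(* The density vanishes off the open quadrant, so the quotients are simplified for positive
   coordinates only. *)
have [pz|/chi2_pdf2_neq0[z1 z2]] := eqVneq (chi2_pdf2 m1 m2 z) 0%R.
  by rewrite pz !mulr0.
rewrite /f /=; have [s1 s2 _] := aw.
have -> : (v1 t * z.1 / (v2 t * z.2) = r * (z.1 / z.2))%R.
  by field; rewrite !gt_eqF.
have -> : (v1 t * z.1 / sigma1 w ^+ 2 + v2 t * z.2 / sigma2 w ^+ 2 = t^-1 * (z.1 +
  z.2))%R.
  by field; rewrite !gt_eqF.
rewrite ger0_norm ?mulr_ge0 ?invr_ge0 ?addr_ge0 ?ltW// exprMn exprVn; ring.
Qed.

Lemma measurable_S1S2_pos : measurable [set x | (0 < S1 x)%R /\ (0 < S2 x)%R].
Proof.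
rewrite (_ : [set x | _] = (S1 @^-1` [set t | (0 < t)%R])
  `&` (S2 @^-1` [set t | (0 < t)%R]))//.
apply: measurableI; rewrite -[X in measurable X]setTI.
  by apply: (meas_S1 model) => //; exact: measurable_pos.
by apply: (meas_S2 model) => //; exact: measurable_pos.
Qed.

(** The transfer formula is applied to the indicator of the complement of the open quadrant, where
    the joint density is 0. *)
Lemma S1S2_pos_ae : P (~` [set x | (0 < S1 x)%R /\ (0 < S2 x)%R]) = 0.
Proof.
pose Q : set (R * R) := [set t | (0 < t)%R] `*` [set t | (0 < t)%R].
have mQ : measurable (~` Q).
  by apply: measurableC; apply: measurableX; exact: measurable_pos.
pose f (z : R * R) : \bar R := (\1_(~` Q) z)%:E.
have mf : measurable_fun setT f.
  by apply/measurable_EFinP; exact: measurable_indic.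
have f0 z : 0 <= f z by rewrite lee_fin.
have := ge0_expectation_S1S2 Pi_pos model mf f0.
rewrite [in RHS]integral0_eq; last first.
  move=> t /= t0; apply: integral0_eq => z _.
  have [->|/chi2_pdf2_neq0[z1 z2]] := eqVneq (chi2_pdf2 m1 m2 z) 0%R;
    first by rewrite mule0.
  rewrite /f indicE memNset ?mul0e//=.
  by apply; split => /=; rewrite mulr_gt0 ?divr_gt0.
move=> <-; rewrite -[X in P X]setIT -integral_indic//.
exact/measurableC/measurable_S1S2_pos.
Qed.

(** [Z] exceeds any level [c] with positive probability; this is the source of the strict
    inequalities between risks. *)
Lemma ratio_integral_gt0 (g : R -> R) (c : R) :
  measurable_fun setT g -> (forall x, (0 <= g x)%R) ->
  (forall x, (c < x)%R -> (0 < g x)%R) -> 0 < ratio_integral m1 m2 g r 0.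
Proof.
move=> mg g0 gc.
have r0 : (0 < r)%R by rewrite divr_gt0.
pose a : R := (`|c| / r)%R.
have a0 : (0 <= a)%R by rewrite divr_ge0// ltW.
(* On this unit square [z.2 < 1], hence [r * (z.1 / z.2) > r * a = |c|]. *)
apply: (@ge0_integral_gt0 _ _ _ leb2 _ (`]a, (a + 1)%R[ `*` `]0%R, 1%R[)).
- apply/measurable_EFinP; apply: measurable_funM; last exact: measurable_chi2_pdf2.
  apply: measurable_funM => //; apply: (measurableT_comp mg).
  by apply: measurable_funM => //; exact: measurable_fun_div.
- by move=> z; rewrite lee_fin expr0 mulr1 mulr_ge0// chi2_pdf2_ge0.
- exact: measurableX.
- rewrite [ltRHS]product_measure1E//= !lebesgue_measure_itv/= !lte_fin ltrDl ltr01.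
  by rewrite -!EFinB -EFinM lte_fin addrAC subrr add0r subr0 mulr1.
- move=> z [] /=; rewrite !in_itv/= => /andP[z1 _] /andP[z2 z2'].
  have z10 : (0 < z.1)%R by exact: le_lt_trans z1.
  rewrite lte_fin expr0 mulr1 mulr_gt0//.
    apply: gc; apply: (le_lt_trans (ler_norm c)).
    rewrite -ltr_pdivrMl// mulrC; apply: (lt_le_trans z1).
    by rewrite ler_pdivlMr// ler_piMr// ltW.
  rewrite lt_neqAle chi2_pdf2_ge0 andbT eq_sym; apply/negP => /eqP.
  rewrite chi2_pdf2E z10 z2 /= => /eqP.
  rewrite mulf_eq0 (gt_eqF (expR_gt0 _)) orbF mulf_eq0 => /orP[|/eqP C0].
    by rewrite gt_eqF// mulr_gt0 ?powR_gt0.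
  (* If the normalising constant were 0, the joint density would vanish identically and the total
     mass of [P] would be 0 instead of 1. *)
  have := @ge0_expectation_S1S2 _ _ _ _ _ _ _ _ _ _ _ _ _ _ _ Pi_pos model (cst 1)
    (measurable_cst _) (fun=> lee01).
  have -> : \int[P]_x cst 1 (S1 x, S2 x) = 1.
    by rewrite [LHS](integral_cst P measurableT 1) mul1e; exact: probability_setT.
  rewrite integral0_eq => [/eqP|t _]; first by rewrite onee_eq0.
  apply: integral0_eq => z' _; rewrite chi2_pdf2E C0 mulr0.
  by case: ifP => _; rewrite mul0r mule0.
Qed.

End model.

(** * Comparison of risks *)

(** The balance uses sums, so that no difference of infinite integrals can occur. The integral of
    [b] is finite, being below that of [a]; with [L] integrable, the balance then makes all four
    integrals finite. *)
Lemma integral_lt_of_balance d (T : measurableType d) (R : realType)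
    (mu : {measure set T -> \bar R}) (D : set T) (L' L a b : T -> R) :
  measurable D -> mu (~` D) = 0%E ->
  measurable_fun setT L' -> measurable_fun setT L ->
  measurable_fun setT a -> measurable_fun setT b ->
  (forall x, D x -> 0 <= L' x) -> (forall x, D x -> 0 <= L x) ->
  (forall x, 0 <= a x) -> (forall x, 0 <= b x) ->
  (forall x, D x -> L' x + a x = L x + b x) ->
  (\int[mu]_x (L x)%:E \is a fin_num)%E ->
  (\int[mu]_x (b x)%:E < \int[mu]_x (a x)%:E)%E ->
  (\int[mu]_x (L' x)%:E < \int[mu]_x (L x)%:E)%E.
Proof.
move=> mD D0 mL' mL ma mb L'0 L0 a0 b0 balance.
have full (f : T -> R) : measurable_fun setT f ->
    (\int[mu]_x (f x)%:E = \int[mu]_(x in D) (f x)%:E)%E.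
  by move=> mf; apply: integral_full_set => //; apply/measurable_EFinP.
rewrite !full//.
have mE (f : T -> R) : measurable_fun setT f -> measurable_fun D (EFin \o f).
  by move=> mf; apply/measurable_EFinP; exact: measurable_funTS.
have add (f g : T -> R) : measurable_fun setT f -> measurable_fun setT g ->
    (forall x, D x -> 0 <= f x) -> (forall x, D x -> 0 <= g x) ->
    (\int[mu]_(x in D) (f x)%:E + \int[mu]_(x in D) (g x)%:E =
     \int[mu]_(x in D) (f x + g x)%:E)%E.
  move=> mf mg f0 g0; under [RHS]eq_integral do rewrite EFinD.
  by rewrite ge0_integralD//; exact: mE.
have : (\int[mu]_(x in D) (L' x)%:E + \int[mu]_(x in D) (a x)%:E =
        \int[mu]_(x in D) (L x)%:E + \int[mu]_(x in D) (b x)%:E)%E.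
  rewrite !add//; apply: eq_integral => x; rewrite inE => /balance.
  by move=> ->.
have: (0 <= \int[mu]_(x in D) (L' x)%:E)%E by apply: integral_ge0 => x Dx;
  rewrite lee_fin L'0.
have: (0 <= \int[mu]_(x in D) (a x)%:E)%E by apply: integral_ge0 => x Dx; rewrite lee_fin.
have: (0 <= \int[mu]_(x in D) (b x)%:E)%E by apply: integral_ge0 => x Dx; rewrite lee_fin.
move: (\int[mu]_(x in D) (L' x)%:E)%E (\int[mu]_(x in D) (a x)%:E)%E
  (\int[mu]_(x in D) (L x)%:E)%E (\int[mu]_(x in D) (b x)%:E)%E.
move=> [l'| |] [u| |] [l| |] [v| |]//= _ _ _ [] + _; rewrite !lte_fin; lra.
Qed.

Section comparison.
Context (R : realType) (p q m1 m2 : nat) (Pi : probability R R)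
  (d : measure_display) (T : measurableType d) (P : probability T R)
  (tau : T -> R) (X1 : T -> 'rV[R]_p) (S1 : T -> R)
  (X2 : T -> 'rV[R]_q) (S2 : T -> R) (w : param R p q).
Hypothesis Pi_pos : Pi [set t : R | 0 < t] = 1%E.
Hypothesis m1_gt0 : (0 < m1)%N.
Hypothesis aw : admissible w.
Hypothesis model : scale_mixture_model m1 m2 Pi P tau X1 S1 X2 S2 w.
Local Open Scope ereal_scope.

Local Notation Z x := (S1 x / S2 x)%R.
Local Notation W x := (S1 x / sigma1 w ^+ 2 + S2 x / sigma2 w ^+ 2)%R.
Local Notation r := (sigma1 w ^+ 2 / sigma2 w ^+ 2)%R.

Lemma measurable_ratio : measurable_fun setT (fun x => Z x).
Proof. exact: measurable_fun_div (meas_S1 model) (meas_S2 model). Qed.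

Lemma inv_moment0 : inv_moment Pi 0 = 1.
Proof.
rewrite inv_momentE//; under eq_integral do rewrite expr0 invr1.
by rewrite integral_cst ?mul1e//; exact: measurable_pos.
Qed.

Lemma ge0_expectation_ratio0 (g : R -> R) :
  measurable_fun setT g -> (forall x, (0 <= g x)%R) ->
  \int[P]_x (g (Z x))%:E = ratio_integral m1 m2 g r 0.
Proof.
move=> mg g0; rewrite -[RHS]mul1e -inv_moment0.
rewrite -(ge0_expectation_ratio Pi_pos aw model 0 mg g0).
by apply: eq_integral => x _; rewrite expr0 mulr1.
Qed.

(** Replaces [|W|] by its mean given [Z], which is the constant [E (tau^-1) * (m1 + m2)]. *)
Lemma ge0_expectation_ratio1 (g : R -> R) : inv_moment Pi 1 \is a fin_num ->
  measurable_fun setT g -> (forall x, (0 <= g x)%R) ->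
  \int[P]_x (g (Z x) * `|W x|)%:E =
  \int[P]_x (fine (inv_moment Pi 1) * (m1 + m2)%:R * g (Z x))%:E.
Proof.
move=> e1 mg g0; under [RHS]eq_integral do rewrite EFinM.
have e1_ge0 : (0 <= fine (inv_moment Pi 1))%R by rewrite fine_ge0// ltW// inv_moment_gt0.
rewrite ge0_integralZl//; last 3 first.
- by apply/measurable_EFinP; apply: (measurableT_comp mg); exact: measurable_ratio.
- by move=> x _; rewrite lee_fin.
- by rewrite lee_fin mulr_ge0.
rewrite ge0_expectation_ratio0// EFinM fineK// -muleA -ratio_integral1//.
rewrite -(ge0_expectation_ratio Pi_pos aw model 1 mg g0).
by apply: eq_integral => x _; rewrite expr1.
Qed.

(** Likewise for the second moment of [W] given [Z]. *)
Lemma ge0_expectation_ratio2 (g : R -> R) : inv_moment Pi 2 \is a fin_num ->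
  measurable_fun setT g -> (forall x, (0 <= g x)%R) ->
  \int[P]_x (g (Z x) * `|W x| ^+ 2)%:E =
  \int[P]_x (fine (inv_moment Pi 2) * ((m1 + m2 + 2) * (m1 + m2))%:R * g (Z x))%:E.
Proof.
move=> e2 mg g0; under [RHS]eq_integral do rewrite EFinM.
have e2_ge0 : (0 <= fine (inv_moment Pi 2))%R by rewrite fine_ge0// ltW// inv_moment_gt0.
rewrite ge0_integralZl//; last 3 first.
- by apply/measurable_EFinP; apply: (measurableT_comp mg); exact: measurable_ratio.
- by move=> x _; rewrite lee_fin.
- by rewrite lee_fin mulr_ge0.
rewrite ge0_expectation_ratio0// EFinM fineK// -muleA -ratio_integral2//.
exact: (ge0_expectation_ratio Pi_pos aw model 2 mg g0).
Qed.

(** The bound [K] makes the integral of [gb] finite, so adding the strictly positive integral of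
    [ga - gb] increases it strictly. *)
Lemma expectation_ratio_lt (ga gb : R -> R) (c K : R) :
  measurable_fun setT ga -> measurable_fun setT gb ->
  (forall x, 0 <= gb x <= K)%R -> (forall x, gb x <= ga x)%R ->
  (forall x, c < x -> gb x < ga x)%R ->
  \int[P]_x (gb (Z x))%:E < \int[P]_x (ga (Z x))%:E.
Proof.
move=> mga mgb gbK gab gablt.
have gb0 x : (0 <= gb x)%R by have /andP[] := gbK x.
pose u x := (ga x - gb x)%R.
have u0 x : (0 <= u x)%R by rewrite subr_ge0.
have mu_ : measurable_fun setT u by exact: measurable_funB.
have mZ (g : R -> R) : measurable_fun setT g ->
  measurable_fun setT (fun x => (g (Z x))%:E).
  by move=> mg; apply/measurable_EFinP; apply: (measurableT_comp mg);
    exact: measurable_ratio.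
have -> : \int[P]_x (ga (Z x))%:E = \int[P]_x (gb (Z x))%:E + \int[P]_x (u (Z x))%:E.
  rewrite -ge0_integralD//; do ?[exact: mZ | by move=> x _; rewrite lee_fin].
  by apply: eq_integral => x _; rewrite -EFinD /u addrC subrK.
have up : 0 < \int[P]_x (u (Z x))%:E.
  rewrite ge0_expectation_ratio0//;
    apply: (ratio_integral_gt0 Pi_pos aw model (c := c)) => //.
  by move=> x /gablt; rewrite subr_gt0.
rewrite -[ltLHS]adde0 lteD2lE//.
rewrite ge0_fin_numE; last by apply: integral_ge0 => x _; rewrite lee_fin.
apply: (@le_lt_trans _ _ (\int[P]_x (cst K%:E x))).
  apply: ge0_le_integral => //; [|exact: mZ|].
  - by move=> x _; rewrite lee_fin.
  - by move=> x _; rewrite lee_fin; have /andP[] := gbK (Z x).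
by rewrite integral_cst//= probability_setT mule1 ltry.
Qed.
End comparison.

(** * The losses and logarithmic inequalities *)

Section loss.
Context {R : realType}.

Lemma measurable_squared_loss d (T : measurableType d) (f : T -> R) (s : R) :
  measurable_fun setT f -> measurable_fun setT (fun x => squared_loss (f x) s).
Proof.
by move=> mf; apply: measurable_funX; apply: measurable_funB => //;
  exact: measurable_funM.
Qed.

Lemma measurable_entropy_loss d (T : measurableType d) (f : T -> R) (s : R) :
  measurable_fun setT f -> measurable_fun setT (fun x => entropy_loss (f x) s).
Proof.
move=> mf; have mfs : measurable_fun setT (fun x => f x / s) by exact: measurable_funM.
apply: measurable_funB => //; apply: measurable_funB => //.
exact: (measurableT_comp (@measurable_ln R)).
Qed.

Lemma entropy_loss_ge0 (x s : R) : 0 < x -> 0 < s -> 0 <= entropy_loss x s.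
Proof.
move=> x0 s0; have u0 : 0 < x / s by exact: divr_gt0.
have := expR_ge1Dx (ln (x / s)); rewrite lnK ?posrE// /entropy_loss; lra.
Qed.

(** This is [1 + y < expR y] at [y = - ln t]. *)
Lemma ln_gt1BV (t : R) : 1 < t -> 1 - t^-1 < ln t.
Proof.
move=> t1; have t0 : 0 < t by exact: lt_trans t1.
have lt0 : - ln t != 0 by rewrite oppr_eq0 gt_eqF// ln_gt0.
by have := expR_gt1Dx lt0; rewrite expRN lnK ?posrE//; lra.
Qed.

Lemma ln_ge1BV (t : R) : 1 <= t -> 1 - t^-1 <= ln t.
Proof.
rewrite le_eqVlt => /orP[/eqP <-|/ln_gt1BV/ltW//].
by rewrite ln1 invr1 subrr.
Qed.

End loss.

(** * Strict inequality of the risks at each admissible parameter *)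

Section domination.
Context (R : realType) (p q m1 m2 : nat) (Pi : probability R R)
  (d : measure_display) (T : measurableType d) (P : probability T R)
  (tau : T -> R) (X1 : T -> 'rV[R]_p) (S1 : T -> R)
  (X2 : T -> 'rV[R]_q) (S2 : T -> R) (w : param R p q).
Hypothesis Pi_pos : Pi [set t : R | 0 < t] = 1%E.
Hypothesis m1_gt0 : (0 < m1)%N.
Hypothesis aw : admissible w.
Hypothesis model : scale_mixture_model m1 m2 Pi P tau X1 S1 X2 S2 w.
Hypothesis moment1 : inv_moment Pi 1 \is a fin_num.

Local Notation e1 := (fine (inv_moment Pi 1)).
Local Notation e2 := (fine (inv_moment Pi 2)).
Local Notation Z x := (S1 x / S2 x).
Local Notation W x := (S1 x / sigma1 w ^+ 2 + S2 x / sigma2 w ^+ 2).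
Local Notation r := (sigma1 w ^+ 2 / sigma2 w ^+ 2).
Local Notation D := [set x | 0 < S1 x /\ 0 < S2 x].

Let e1_gt0 : 0 < e1.
Proof. by rewrite fine_gt0// inv_moment_gt0//= -ge0_fin_numE// ltW// inv_moment_gt0. Qed.

Let r_gt0 : 0 < r.
Proof. by case: aw => s1 s2 _; rewrite divr_gt0 ?exprn_gt0. Qed.

Let r_le1 : r <= 1.
Proof.
case: aw => s1 s2 s12; rewrite ler_pdivrMr ?exprn_gt0// mul1r.
by rewrite ler_sqr // nnegrE ltW.
Qed.

Let mS1 := meas_S1 model.
Let mS2 := meas_S2 model.
Let mZ := measurable_ratio model.

(** Solved for [S2 / sigma2^2], this writes the loss of [phi Z * S2] in terms of [Z] and [W]. *)
Let W_E x : D x -> W x = S2 x / sigma2 w ^+ 2 * (1 + Z x / r).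
Proof. by case: aw => s1 s2 _ [x1 x2]; field; rewrite !gt_eqF. Qed.

Let W_ge0 x : D x -> 0 <= W x.
Proof. by case=> x1 x2; apply: addr_ge0; apply: divr_ge0; rewrite ?sqr_ge0 ?ltW. Qed.

Let mW : measurable_fun setT (fun x => W x).
Proof. by apply: measurable_funD; apply: measurable_funM. Qed.

Let X_gt0 z : 0 <= z -> 0 < 1 + z / r.
Proof. by move=> z0; rewrite ltr_pwDl// divr_ge0// ltW. Qed.

(** The order restriction enters here, through [r <= 1]: the unknown factor [1 + z / r] of the
    optimal multiplier is at least the computable [1 + z]. *)
Let X_ge z : 0 <= z -> 1 + z <= 1 + z / r.
Proof. by move=> z0; rewrite lerD2l ler_pdivlMr// ler_piMr. Qed.

Let measurable_if_ge (c : R) (g h : R -> R) :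
  measurable_fun setT g -> measurable_fun setT h ->
  measurable_fun setT (fun z => if c <= z then g z else h z).
Proof. by move=> mg mh; apply: measurable_fun_ifT => //; exact: measurable_fun_ler. Qed.

(** Where [Z >= thr], with [X = 1 + Z / r], the loss changes by [(phi^2 - c0^2) W^2 / X^2 - 2 (phi -
    c0) W / X]. After averaging [W] given [Z], this is at most 0 as soon as
    [e2 * M2 * (phi + c0) <= 2 * e1 * X]. *)
Lemma squared_risk_lt : inv_moment Pi 2 \is a fin_num ->
  (\int[P]_x (squared_loss (delta02Q m2 Pi (S2 x)) (sigma2 w ^+ 2))%:E \is a fin_num)%E ->
  (\int[P]_x (squared_loss (delta21Q m1 m2 Pi (S1 x) (S2 x)) (sigma2 w ^+ 2))%:E <
   \int[P]_x (squared_loss (delta02Q m2 Pi (S2 x)) (sigma2 w ^+ 2))%:E)%E.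
Proof.
move=> moment2 finL.
have e2_gt0 : 0 < e2.
  by rewrite fine_gt0// inv_moment_gt0//= -ge0_fin_numE// ltW// inv_moment_gt0.
pose M : R := (m1 + m2)%:R; pose M2 : R := (m1 + m2 + 2)%:R; pose n2 : R := (m2 + 2)%:R.
have M0 : 0 < M by rewrite ltr0n addn_gt0 m1_gt0.
have M20 : 0 < M2 by rewrite ltr0n addn2.
have n20 : 0 < n2 by rewrite ltr0n addn2.
have m10 : 0 < m1%:R :> R by rewrite ltr0n.
have M2E : M2 = m1%:R + n2 by rewrite -natrD addnA.
pose thr : R := m1%:R / n2.
have thr0 : 0 < thr by exact: divr_gt0.
pose c0 : R := e1 / (n2 * e2); pose phi (z : R) : R := (1 + z) / M2 * (e1 / e2).
have c00 : 0 < c0 by rewrite divr_gt0// mulr_gt0.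
(* The sign of [phi - c0] changes at [thr], so the new estimator uses the larger of the two
   multipliers. *)
have phi_c0 z : phi z - c0 = e1 / e2 * (z - thr) / M2.
  by rewrite /phi /c0 /thr M2E; field; rewrite !gt_eqF// addr_gt0.
have phi_ge z : thr <= z -> c0 <= phi z.
  move=> z0; rewrite -subr_ge0 phi_c0 divr_ge0 ?(ltW M20)// mulr_ge0 ?subr_ge0//.
  by rewrite divr_ge0// ltW.
have phi_gt z : thr < z -> c0 < phi z.
  by move=> z0; rewrite -subr_gt0 phi_c0 !(divr_gt0, mulr_gt0, subr_gt0).
pose g1 z := if thr <= z then 2 * (phi z - c0) / (1 + z / r) else 0.
pose g2 z := if thr <= z then (phi z - c0) * (phi z + c0) / (1 + z / r) ^+ 2 else 0.
have mphi : measurable_fun setT phi.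
  by apply: measurable_funM => //; apply: measurable_funM => //; exact: measurable_funD.
have mX : measurable_fun setT (fun z : R => 1 + z / r).
  by apply: measurable_funD => //; exact: measurable_funM.
have mg1 : measurable_fun setT g1.
  apply: measurable_if_ge => //; apply: measurable_fun_div => //.
  by apply: measurable_funM => //; exact: measurable_funB.
have mg2 : measurable_fun setT g2.
  apply: measurable_if_ge => //; apply: measurable_fun_div => //.
    by apply: measurable_funM; [exact: measurable_funB|exact: measurable_funD].
  exact: measurable_funX.
have zX z : thr <= z -> 0 < 1 + z / r by move=> z0; apply: X_gt0;
  rewrite (le_trans _ z0)// ltW.
have g10 z : 0 <= g1 z.
  rewrite /g1; case: ifP => // z0; rewrite divr_ge0 ?(ltW (zX _ z0))//.
  by rewrite mulr_ge0// subr_ge0 phi_ge.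
have g20 z : 0 <= g2 z.
  rewrite /g2; case: ifP => // z0; rewrite divr_ge0 ?exprn_ge0 ?(ltW (zX _ z0))//.
  by rewrite mulr_ge0 ?subr_ge0 ?phi_ge// addr_ge0 ?(ltW c00)// (le_trans (ltW
    c00))// phi_ge.
apply: (@integral_lt_of_balance _ _ _ P D _ _
  (fun x => g1 (Z x) * `|W x|) (fun x => g2 (Z x) * `|W x| ^+ 2)) => //.
- exact: (measurable_S1S2_pos model).
- exact: (S1S2_pos_ae Pi_pos aw model).
- apply: measurable_squared_loss; apply: measurable_fun_ifT;
    first exact: measurable_fun_ler.
    do 2 apply: measurable_funM => //; apply: measurable_funM => //.
    exact: measurable_funD.
  by apply: measurable_funM => //; apply: measurable_funM.
- by apply: measurable_squared_loss; exact: measurable_funM.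
- apply: measurable_funM; first exact: (measurableT_comp mg1).
  exact: measurableT_comp.
- apply: measurable_funM; first exact: (measurableT_comp mg2).
  by apply: measurable_funX; exact: measurableT_comp.
- by move=> x _; exact: sqr_ge0.
- by move=> x _; exact: sqr_ge0.
- by move=> x; rewrite mulr_ge0.
- by move=> x; rewrite mulr_ge0// exprn_ge0.
- move=> x Dx; rewrite ger0_norm ?W_ge0// W_E//.
  have [x1 x2] := Dx.
  rewrite /squared_loss /delta21Q /delta02Q /g1 /g2 -/thr.
  case: ifPn => z0; last first.
    (* Below the threshold both estimators coincide. *)
    by rewrite !mul0r !addr0; congr ((_ / _ - 1) ^+ 2); field; rewrite !gt_eqF.
  have := zX _ z0; rewrite /phi -/M2 -/n2 -/c0.
  set z := S1 x / S2 x; set X := 1 + z / r => X0.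
  by field; case: aw => s1 s2 _; rewrite !gt_eqF.
- rewrite (ge0_expectation_ratio1 Pi_pos m1_gt0 aw model)//.
  rewrite (ge0_expectation_ratio2 Pi_pos m1_gt0 aw model)//.
  pose ga z := e1 * M * g1 z; pose gb z := e2 * ((m1 + m2 + 2) * (m1 + m2))%:R * g2 z.
  (* Both sides share the factor [h], which reduces the comparison to [t z <= 2 * e1]. *)
  pose h z := M * ((phi z - c0) / (1 + z / r)).
  pose t z := e2 * M2 * (phi z + c0) / (1 + z / r).
  have gaE z : thr <= z -> ga z = h z * (2 * e1).
    by move=> z0; rewrite /ga /g1 /h z0; ring.
  have gbE z : thr <= z -> gb z = h z * t z.
    move=> z0; rewrite /gb /g2 /h /t z0 natrM -/M -/M2.
    by move: (zX _ z0); set X := 1 + z / r => X0; field; rewrite gt_eqF.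
  have h0 z : thr <= z -> 0 <= h z.
    move=> z0; rewrite /h mulr_ge0 ?(ltW M0)// divr_ge0 ?(ltW (zX _ z0))//.
    by rewrite subr_ge0 phi_ge.
  have phiE z : e2 * M2 * phi z = e1 * (1 + z) by rewrite /phi; field; rewrite !gt_eqF.
  have Xz z : thr <= z -> e1 * (1 + z) <= e1 * (1 + z / r).
    by move=> z0; rewrite ler_pM2l// X_ge// (le_trans (ltW thr0)).
  (* Each of the terms [e2 * M2 * phi z = e1 * (1 + z)] and [e2 * M2 * c0], which is no larger, is
     at most [e1 * (1 + z / r)]. *)
  have t_le z : thr <= z -> t z <= 2 * e1.
    move=> z0; have U := Xz _ z0.
    have V : e2 * M2 * c0 <= e1 * (1 + z) by rewrite -phiE ler_pM2l ?mulr_gt0 ?phi_ge.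
    rewrite /t ler_pdivrMr ?zX// [_ * (phi z + c0)]mulrDr phiE.
    rewrite (_ : 2 * e1 * (1 + z / r) = e1 * (1 + z / r) + e1 * (1 + z / r));
      last by ring.
    by rewrite lerD// (le_trans V).
  have t_lt z : thr < z -> t z < 2 * e1.
    move=> z0; have U := Xz _ (ltW z0).
    have V : e2 * M2 * c0 < e1 * (1 + z) by rewrite -phiE ltr_pM2l ?mulr_gt0 ?phi_gt.
    rewrite /t ltr_pdivrMr ?zX ?ltW// [_ * (phi z + c0)]mulrDr phiE.
    rewrite (_ : 2 * e1 * (1 + z / r) = e1 * (1 + z / r) + e1 * (1 + z / r));
      last by ring.
    by rewrite ler_ltD// (lt_le_trans V).
  have gab z : gb z <= ga z.
    have [z0|z0] := leP thr z; first by rewrite gaE// gbE// ler_wpM2l ?h0 ?t_le.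
    by rewrite /ga /gb /g1 /g2 (lt_geF z0) !mulr0.
  (* The bound comes from [phi - c0 <= phi = e1 / e2 / M2 * (1 + z)] and [1 + z <= 1 + z / r]. *)
  apply: (@expectation_ratio_lt _ _ _ _ _ _ _ _ _ _ _ _ _ _ _ Pi_pos aw model ga gb thr
    (2 * e1 * M * (e1 / e2 / M2))) => //.
  + exact: measurable_funM.
  + exact: measurable_funM.
  + move=> z; rewrite mulr_ge0 ?mulr_ge0 ?(ltW e2_gt0)//=.
    apply: (le_trans (gab z)); have [z0|z0] := leP thr z; last first.
      by rewrite /ga /g1 (lt_geF z0) mulr0 ltW// !(mulr_gt0, invr_gt0).
    rewrite gaE// (_ : h z * _ = 2 * e1 * M * ((phi z - c0) / (1 + z / r)));
      last by rewrite /h; ring.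
    rewrite ler_pM2l ?mulr_gt0// ler_pdivrMr ?zX//.
    apply: (@le_trans _ _ (e1 / e2 / M2 * (1 + z))).
      have <- : phi z = e1 / e2 / M2 * (1 + z) by rewrite /phi; ring.
      by rewrite gerBl ltW.
    rewrite ler_pM2l ?divr_gt0//; apply: X_ge; exact: le_trans (ltW thr0) z0.
  + move=> z z0; rewrite gaE ?ltW// gbE ?ltW// ltr_pM2l ?t_lt//.
    by rewrite /h mulr_gt0// divr_gt0 ?zX ?ltW// subr_gt0 phi_gt.
Qed.

(** Where [Z >= thr], the loss changes by [(phi - c0) W / X - ln (phi / c0)]. The first term
    averages, given [Z], to at most [1 - c0 / phi], and [1 - 1 / u <= ln u] for
    [u = phi / c0 >= 1]. *)
Lemma entropy_risk_lt : (0 < m2)%N ->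
  (\int[P]_x (entropy_loss (delta02E m2 Pi (S2 x)) (sigma2 w ^+ 2))%:E \is a fin_num)%E ->
  (\int[P]_x (entropy_loss (delta21E m1 m2 Pi (S1 x) (S2 x)) (sigma2 w ^+ 2))%:E <
   \int[P]_x (entropy_loss (delta02E m2 Pi (S2 x)) (sigma2 w ^+ 2))%:E)%E.
Proof.
move=> m2_gt0 finL.
have [s1 s2 _] := aw; have s20 : 0 < sigma2 w ^+ 2 by rewrite exprn_gt0.
pose M : R := (m1 + m2)%:R.
have M0 : 0 < M by rewrite ltr0n addn_gt0 m1_gt0.
have m10 : 0 < m1%:R :> R by rewrite ltr0n.
have m20 : 0 < m2%:R :> R by rewrite ltr0n.
have ME : M = m1%:R + m2%:R by rewrite -natrD.
pose thr : R := m1%:R / m2%:R.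
have thr0 : 0 < thr by exact: divr_gt0.
pose c0 : R := (m2%:R * e1)^-1; pose phi (z : R) : R := (1 + z) / (M * e1).
have c00 : 0 < c0 by rewrite invr_gt0 mulr_gt0.
have phi_c0 z : phi z - c0 = (z - thr) / (M * e1).
  by rewrite /phi /c0 /thr ME; field; rewrite !gt_eqF// addr_gt0.
have phi_ge z : thr <= z -> c0 <= phi z.
  by move=> z0; rewrite -subr_ge0 phi_c0 divr_ge0 ?subr_ge0// mulr_ge0 ?ltW.
have phi_gt z : thr < z -> c0 < phi z.
  by move=> z0; rewrite -subr_gt0 phi_c0 divr_gt0 ?subr_gt0// mulr_gt0.
have phi0 z : thr <= z -> 0 < phi z by move=> /phi_ge; exact: lt_le_trans.
pose h z := if thr <= z then (phi z - c0) / (1 + z / r) else 0.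
pose la z := if thr <= z then ln (phi z / c0) else 0.
have mphi : measurable_fun setT phi.
  by apply: measurable_funM => //; exact: measurable_funD.
have mX : measurable_fun setT (fun z : R => 1 + z / r).
  by apply: measurable_funD => //; exact: measurable_funM.
have mh : measurable_fun setT h.
  apply: measurable_if_ge => //; apply: measurable_fun_div => //.
  exact: measurable_funB.
have mla : measurable_fun setT la.
  apply: measurable_if_ge => //; apply: (measurableT_comp (@measurable_ln R)).
  exact: measurable_funM.
have z_gt0 z : thr <= z -> 0 < z by exact: lt_le_trans.
have zX z : thr <= z -> 0 < 1 + z / r by move=> /z_gt0 z0; apply: X_gt0; exact: ltW.
have h0 z : 0 <= h z.
  rewrite /h; case: ifP => // z0; rewrite divr_ge0 ?(ltW (zX _ z0))//.
  by rewrite subr_ge0 phi_ge.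
have phi_ge1 z : thr <= z -> 1 <= phi z / c0.
  by move=> z0; rewrite ler_pdivlMr// mul1r phi_ge.
have la0 z : 0 <= la z.
  by rewrite /la; case: ifP => // z0; rewrite ln_ge0// phi_ge1.
apply: (@integral_lt_of_balance _ _ _ P D _ _
  (fun x => la (Z x)) (fun x => h (Z x) * `|W x|)) => //.
- exact: (measurable_S1S2_pos model).
- exact: (S1S2_pos_ae Pi_pos aw model).
- apply: measurable_entropy_loss; apply: measurable_fun_ifT;
    first exact: measurable_fun_ler.
    apply: measurable_funM => //; apply: measurable_funM => //.
    exact: measurable_funD.
  exact: measurable_funM.
- by apply: measurable_entropy_loss; exact: measurable_funM.
- exact: (measurableT_comp mla).
- apply: measurable_funM; first exact: (measurableT_comp mh).
  exact: measurableT_comp.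
- move=> x [x1 x2]; apply: entropy_loss_ge0 => //; rewrite /delta21E.
  by case: ifP => _; rewrite divr_gt0 ?mulr_gt0// addr_gt0// divr_gt0.
- by move=> x [x1 x2]; apply: entropy_loss_ge0 => //; rewrite divr_gt0// mulr_gt0.
- by move=> x; rewrite mulr_ge0.
- move=> x Dx; rewrite ger0_norm ?W_ge0// W_E//.
  have [x1 x2] := Dx.
  rewrite /entropy_loss /delta21E /delta02E /h /la -/thr.
  case: ifPn => z0; first last.
    by rewrite mul0r.
  set z := S1 x / S2 x; rewrite -/z in z0.
  have -> : (1 + z) * S2 x / ((m1 + m2)%:R * e1)
    / sigma2 w ^+ 2 = phi z * (S2 x / sigma2 w ^+ 2).
    by rewrite /phi -/M; ring.
  have -> : S2 x / (m2%:R * e1) / sigma2 w ^+ 2 = c0 * (S2 x / sigma2 w ^+ 2).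
    by rewrite /c0; field; rewrite !gt_eqF.
  have v0 : 0 < S2 x / sigma2 w ^+ 2 by exact: divr_gt0.
  move: (S2 x / sigma2 w ^+ 2) v0 => v v0.
  rewrite (@ln_div _ (phi z) c0) ?posrE ?phi0//.
  rewrite (@lnM _ (phi z) v) ?posrE ?phi0// (@lnM _ c0 v) ?posrE//.
  have := zX _ z0; set X := 1 + z / r => X0.
  by field; rewrite !gt_eqF.
- rewrite (ge0_expectation_ratio1 Pi_pos m1_gt0 aw model)//.
  pose gb z := e1 * M * h z.
  have gb_le z : thr <= z -> gb z <= 1 - (phi z / c0)^-1.
    move=> z0; have Y0 : 0 < 1 + z by rewrite addr_gt0// z_gt0.
    (* Since [phi z = (1 + z) / (M * e1)], only [1 + z] and [1 + z / r] remain to be compared. *)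
    have -> : 1 - (phi z / c0)^-1 = e1 * M * ((phi z - c0) / (1 + z)).
      by rewrite /phi /c0; field; rewrite !gt_eqF// addr_gt0.
    rewrite /gb /h z0 ler_wpM2l// ?mulr_ge0 ?(ltW e1_gt0)//.
    rewrite ler_wpM2l ?subr_ge0 ?phi_ge// lef_pV2 ?posrE ?zX//.
    by apply: X_ge; rewrite ltW ?z_gt0.
  have gb_out z : z < thr -> gb z = 0 by move=> z0; rewrite /gb /h (lt_geF z0) mulr0.
  apply: (@expectation_ratio_lt _ _ _ _ _ _ _ _ _ _ _ _ _ _ _ Pi_pos aw model la gb
    thr 1) => //.
  + exact: measurable_funM.
  + move=> z; rewrite mulr_ge0 ?mulr_ge0 ?(ltW e1_gt0)//=.
    have [z0|z0] := leP thr z; last by rewrite gb_out.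
    apply: (le_trans (gb_le _ z0)).
    by rewrite gerBl invr_ge0 (le_trans ler01)// phi_ge1.
  + move=> z; have [z0|z0] := leP thr z; last by rewrite gb_out.
    by apply: (le_trans (gb_le _ z0)); rewrite /la z0 ln_ge1BV// phi_ge1.
  + move=> z z0; apply: (le_lt_trans (gb_le _ (ltW z0))).
    by rewrite /la (ltW z0) ln_gt1BV// ltr_pdivlMr// mul1r phi_gt.
Qed.

End domination.

Unset Implicit Arguments.

Theorem corollary3p3 (R : realType) (p q m1 m2 : nat)
    (p_gt0 : (0 < p)%N) (q_gt0 : (0 < q)%N)
    (m1_gt0 : (0 < m1)%N) (m2_gt0 : (0 < m2)%N)
    (Pi : probability R R) (Pi_pos : Pi [set t : R | 0 < t] = 1%E)
    (d : measure_display) (T : measurableType d)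
    (P : param R p q -> probability T R)
    (tau : T -> R) (X1 : T -> 'rV[R]_p) (S1 : T -> R)
    (X2 : T -> 'rV[R]_q) (S2 : T -> R)
    (model : forall w : param R p q, admissible w ->
       scale_mixture_model m1 m2 Pi (P w) tau X1 S1 X2 S2 w)
    (moment1 : inv_moment Pi 1 \is a fin_num) :
  (inv_moment Pi 2 \is a fin_num ->
   finite_risk P squared_loss (fun x => delta02Q m2 Pi (S2 x)) ->
   dominates P squared_loss
     (fun x => delta21Q m1 m2 Pi (S1 x) (S2 x))
     (fun x => delta02Q m2 Pi (S2 x)))
  /\
  (finite_risk P entropy_loss (fun x => delta02E m2 Pi (S2 x)) ->
   dominates P entropy_loss
     (fun x => delta21E m1 m2 Pi (S1 x) (S2 x))
     (fun x => delta02E m2 Pi (S2 x))).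
Proof.
(* The risk is strictly smaller at every admissible parameter; zero means and unit scales witness
   that there is one. *)
have dominatesP (L : R -> R -> R) (delta' delta : T -> R) :
    (forall w, admissible w -> (risk P L delta' w < risk P L delta w)%E) ->
    dominates P L delta' delta.
  move=> lt_risk; split; first by move=> w /lt_risk/ltW.
  have aw : admissible (@Param R p q 0 0 1 1) by split.
  by exists (Param 0 0 1 1); split => //; exact: lt_risk.
split.
- move=> moment2 fin; apply: dominatesP => w aw; have := fin w aw.
  rewrite /risk unlock; exact: (squared_risk_lt Pi_pos m1_gt0 aw (model w aw)).
- move=> fin; apply: dominatesP => w aw; have := fin w aw.
  rewrite /risk unlock; exact: (entropy_risk_lt Pi_pos m1_gt0 aw (model w aw)).
Qed.
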